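(* Let $\mathfrak{X}$ be a separable Banach space. Let $\mathfrak{M}\subset\mathfrak{X}^*$ be a norm closed determinant subspace all of whose functionals are norm-attaining. Then $\mathfrak{M}$ is canonically a predual of $\mathfrak{X}$; that is, the map $\Phi:\mathfrak{X}\to\mathfrak{M}^*$ given by $\langle\Phi(x),\varphi\rangle=\varphi(x)$ for all $x\in\mathfrak{X}$ and $\varphi\in\mathfrak{M}$ is an isometric isomorphism of $\mathfrak{X}$ onto $\mathfrak{M}^*$.
   Context: For a Banach space $\mathfrak{X}$, $\mathfrak{X}^*$ denotes its (continuous) dual and $\mathfrak{X}_1=\{x\in\mathfrak{X}:\|x\|\le 1\}$ its unit ball. For a linear subspace $\mathfrak{M}\subset\mathfrak{X}^*$, equipped with the norm of $\mathfrak{X}^*$, $\mathfrak{M}_1$ is its unit ball, and its (Dixmier) characteristic is $c(\mathfrak{M})=\inf_{x\neq 0}\sup_{\varphi\in\mathfrak{M}_1}\frac{|\varphi(x)|}{\|x\|}$. The subspace $\mathfrak{M}$ is called determinant if $c(\mathfrak{M})=1$. A functional $\varphi\in\mathfrak{X}^*$ is norm-attaining if there exists $x\in\mathfrak{X}_1$ with $|\varphi(x)|=\|\varphi\|$. *)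

(* Defs.v *)
From HB Require Import structures.
From mathcomp Require Import all_boot all_order all_algebra.
From mathcomp Require Import complex.
From mathcomp Require Import all_classical all_reals.
From mathcomp Require Import topology normedtype.

Set Implicit Arguments.
Unset Strict Implicit.
Unset Printing Implicit Defensive.

Import Order.TTheory GRing.Theory Num.Theory.
Import numFieldNormedType.Exports.

Local Open Scope classical_set_scope.
Local Open Scope ring_scope.

(* Banach spaces are over R or over C.  Norms in a normedModType K take their
   values in K itself; in R[i] one has x <= y iff y - x is a nonnegative real,
   so the suprema and infima below, of sets of nonnegative reals, have their
   usual meaning for both fields. *)
Variant scalar_kind := RealScalars | ComplexScalars.

Definition scalars (R : realType) (k : scalar_kind) : numFieldType :=
  match k with
  | RealScalars => R
  | ComplexScalars => R[i]
  end.

Lemma scalars_supremums (R : realType) (k : scalar_kind)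
    (A : set (scalars R k)) :
  A !=set0 -> (forall a, A a -> 0 <= a) -> ubound A !=set0 ->
  supremums A !=set0.
Proof.
case: k A => /= A [a0 Aa0] A0 [u uA].
  have hA : has_sup A by split; [exists a0|exists u].
  exists (sup A); split; first exact: sup_upper_bound.
  by move=> v vA; apply: ge_sup; [exists a0|exact: vA].
have AIm a : A a -> complex.Im a = 0.
  by move=> /A0; rewrite lecE => /andP[/eqP].
pose B : set R := [set complex.Re a | a in A].
have ubB v : ubound A v -> ubound B (complex.Re v).
  by move=> vA _ [a Aa <-]; have := vA a Aa; rewrite lecE => /andP[].
have hB : has_sup B.
  by split; [exists (complex.Re a0), a0|exists (complex.Re u); exact: ubB].
exists ((sup B)%:C)%C; split.
  move=> a Aa; rewrite lecE /= AIm// eqxx /=.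
  by apply: sup_upper_bound => //; exists a.
move=> v vA; rewrite lecE /=; apply/andP; split.
  by have := vA a0 Aa0; rewrite lecE (AIm a0)// => /andP[].
by apply: ge_sup; [case: hB|exact: ubB].
Qed.

Section Dual.
Context (R : realType) (k : scalar_kind).
Local Notation K := (scalars R k).
Variable X : normedModType K.

Definition continuous_linear : {pred X -> K^o} :=
  [pred f | `[< linear f /\ continuous f >]].

Record dual := Dual { dual_fun :> X -> K^o ; _ : dual_fun \in continuous_linear }.

HB.instance Definition _ := [isSub of dual for dual_fun].
HB.instance Definition _ := [Choice of dual by <:].

Lemma continuous_linearP (f : X -> K^o) :
  reflect (linear f /\ continuous f) (f \in continuous_linear).
Proof. by rewrite unfold_in; exact: asboolP. Qed.

Fact continuous_linear_submod_closed : submod_closed continuous_linear.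
Proof.
split=> [|a f g /continuous_linearP[lf cf] /continuous_linearP[lg cg]].
  apply/continuous_linearP; split; last by move=> x; exact: cvg_cst.
  by move=> a x y /=; rewrite scaler0 addr0.
apply/continuous_linearP; split.
  move=> b x y; rewrite /= !fctE lf lg !scalerDr !scalerA mulrC -!addrA.
  by congr (_ + _); rewrite addrCA.
by move=> x; apply: cvgD; [apply: cvgZr; exact: cf|exact: cg].
Qed.

HB.instance Definition _ :=
  GRing.isSubmodClosed.Build K (X -> K^o) continuous_linear
    continuous_linear_submod_closed.
HB.instance Definition _ := [SubChoice_isSubLmodule of dual by <:].

Lemma dual_linear (f : dual) : linear f.
Proof. by have /continuous_linearP[] := valP f. Qed.

Lemma dual_continuous (f : dual) : continuous f.
Proof. by have /continuous_linearP[] := valP f. Qed.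

HB.instance Definition _ (f : dual) :=
  GRing.isLinear.Build K X K^o *:%R f (dual_linear f).

Lemma dual_funP (a : K) (f g : dual) (x : X) :
  (a *: f + g) x = a *: f x + g x.
Proof. by rewrite [dual_fun (_ + _)](linearP (val : dual -> X -> K^o)). Qed.

Definition dual_norm (f : dual) : K :=
  supremum 0 [set `|f x| | x in [set x : X | `|x| <= 1]].

Lemma dual_norm_supremums (f : dual) :
  supremums [set `|f x| | x in [set x : X | `|x| <= 1]] (dual_norm f).
Proof.
set A := [set _ | _ in _].
have A0 : A !=set0 by exists `|f 0|, 0 => //=; rewrite normr0.
have : supremums A !=set0.
  apply: scalars_supremums => // [_ [x _ <-]|]; first exact: normr_ge0.
  have : bounded_near f (nbhs (0 : X)).
    by apply: continuous_linear_bounded; exact: dual_continuous.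
  move=> /linear_boundedP/pinfty_ex_gt0[c c0 fc]; exists c => _ [x /= x1 <-].
  by rewrite (le_trans (fc x))// ler_piMr// ltW.
move=> [u Au]; rewrite /dual_norm /supremum -/A ifF; last exact/negbTE/set0P.
by case: xgetP => [y _ //|/(_ u)].
Qed.

Lemma dual_norm_ge0 (f : dual) : 0 <= dual_norm f.
Proof.
have [ubf _] := dual_norm_supremums f; apply: le_trans (normr_ge0 (f 0)) _.
by apply: ubf; exists 0 => //=; rewrite normr0.
Qed.

Lemma le_dual_norm (f : dual) (x : X) : `|f x| <= dual_norm f * `|x|.
Proof.
have [->|x0] := eqVneq x 0; first by rewrite linear0 !normr0 mulr0.
have nx0 : 0 < `|x| by rewrite normr_gt0.
have [ubf _] := dual_norm_supremums f; rewrite -ler_pdivrMr//.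
apply: ubf; exists (`|x|^-1 *: x).
  by rewrite /= normrZ normfV normr_id mulVf// gt_eqF.
by rewrite linearZ /= normrM normfV normr_id mulrC.
Qed.

Lemma dual_norm_le (f : dual) (c : K) :
  (forall x, `|x| <= 1 -> `|f x| <= c) -> dual_norm f <= c.
Proof.
by move=> fc; apply: (dual_norm_supremums f).2 => _ [x x1 <-]; exact: fc.
Qed.

Fact dual_normD (f g : dual) : dual_norm (f + g) <= dual_norm f + dual_norm g.
Proof.
apply: dual_norm_le => x x1; rewrite (le_trans (ler_normD _ _))// lerD//.
  by apply: (dual_norm_supremums f).1; exists x.
by apply: (dual_norm_supremums g).1; exists x.
Qed.

Fact dual_normZ (a : K) (f : dual) : dual_norm (a *: f) = `|a| * dual_norm f.
Proof.
have le_normZ b (g : dual) : dual_norm (b *: g) <= `|b| * dual_norm g.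
  apply: dual_norm_le => x x1; rewrite [leLHS]normrM ler_wpM2l//.
  by apply: (dual_norm_supremums g).1; exists x.
apply/eqP; rewrite eq_le le_normZ /=.
have [->|a0] := eqVneq a 0; first by rewrite normr0 mul0r dual_norm_ge0.
have := le_normZ a^-1 (a *: f); rewrite scalerA mulVf// scale1r normfV.
by rewrite ler_pdivlMl ?normr_gt0.
Qed.

Fact dual_norm0_eq0 (f : dual) : dual_norm f = 0 -> f = 0.
Proof.
move=> f0; apply/val_inj/funext => x /=; apply/eqP; rewrite -normr_le0.
by rewrite (le_trans (le_dual_norm f x))// f0 mul0r.
Qed.

HB.instance Definition _ :=
  Lmodule_isNormed.Build K dual dual_normD dual_normZ dual_norm0_eq0.

End Dual.

Section SubmodSpace.
Context (K : numFieldType) (V : normedModType K) (M : submodClosed V).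

Record submod_space := SubmodSpace { submod_val :> V ; _ : submod_val \in M }.

HB.instance Definition _ := [isSub of submod_space for submod_val].
HB.instance Definition _ := [Choice of submod_space by <:].
HB.instance Definition _ := [SubChoice_isSubLmodule of submod_space by <:].

Lemma submod_valP (a : K) (v w : submod_space) :
  submod_val (a *: v + w) = a *: submod_val v + submod_val w.
Proof. exact: (linearP (val : submod_space -> V)). Qed.

Definition submod_norm (v : submod_space) : K := `|submod_val v|.

Fact submod_normD (v w : submod_space) :
  submod_norm (v + w) <= submod_norm v + submod_norm w.
Proof. exact: ler_normD. Qed.

Fact submod_normZ (a : K) (v : submod_space) :
  submod_norm (a *: v) = `|a| * submod_norm v.
Proof. exact: normrZ. Qed.

Fact submod_norm0_eq0 (v : submod_space) : submod_norm v = 0 -> v = 0.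
Proof. by move=> /normr0_eq0 v0; exact/val_inj. Qed.

HB.instance Definition _ := Lmodule_isNormed.Build K submod_space
  submod_normD submod_normZ submod_norm0_eq0.

End SubmodSpace.

Definition is_separable (T : topologicalType) : Prop :=
  exists D : set T, countable D /\ dense D.

Section Predual.
Context (R : realType) (k : scalar_kind).
Local Notation K := (scalars R k).
Variable X : normedModType K.

(* All the ratios lie in [0, 1], where the infimum of the empty set, which
   occurs only for X = 0, is 1. *)
Definition characteristic (M : submodClosed (dual X)) : K :=
  infimum 1
    [set supremum 0
       [set `|f x| / `|x| | f in [set f : dual X | f \in M /\ `|f| <= 1]]
     | x in [set x : X | x != 0]].

Definition is_determinant (M : submodClosed (dual X)) : Prop :=
  characteristic M = 1.

Definition norm_attaining (f : dual X) : Prop :=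
  exists x : X, `|x| <= 1 /\ `|f x| = `|f|.

Section CanonicalMap.
Variable M : submodClosed (dual X).

Definition evaluation (x : X) (f : submod_space M) : K^o := submod_val f x.

Fact evaluation_linear (x : X) : linear (evaluation x).
Proof. by move=> a f g; rewrite /evaluation submod_valP dual_funP. Qed.

HB.instance Definition _ (x : X) :=
  GRing.isLinear.Build K (submod_space M) K^o *:%R (evaluation x)
    (evaluation_linear x).

Fact evaluation_continuous_linear (x : X) :
  evaluation x \in continuous_linear (X := submod_space M).
Proof.
apply/continuous_linearP; split; first exact: evaluation_linear.
apply: bounded_linear_continuous; apply/linear_boundedP.
near=> r.
have xr : `|x| <= r by near: r; apply: nbhs_pinfty_ge; exact: normr_real.
move=> f; rewrite (le_trans (le_dual_norm (submod_val f) x))//.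
by rewrite mulrC ler_wpM2r// dual_norm_ge0.
Unshelve. all: by end_near. Qed.

Definition canonical_map (x : X) : dual (submod_space M) :=
  Dual (evaluation_continuous_linear x).

End CanonicalMap.
End Predual.

Definition isometric_isomorphism (K : numFieldType) (V W : normedModType K)
    (f : V -> W) : Prop :=
  [/\ linear f, bijective f & forall x, `|f x| = `|x|].

(* Main.v *)
Require Import Defs.
From HB Require Import structures.
From mathcomp Require Import all_boot all_order all_algebra.
From mathcomp Require Import ring lra.
From mathcomp Require Import complex.
From mathcomp Require Import all_classical all_reals.
From mathcomp Require Import topology normedtype.

(** The map Phi : X -> M^* is isometric because the characteristic of M is 1
    ([norm_canonical_map]); the content is that it is onto.  This is James'
    argument for the reflexivity of separable spaces all of whose functionals
    attain their norm, run on M with X in the place of M^*.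

    Suppose F in M^* is not in the range of Phi.  The range is complete, hence
    F has distance more than some t > 0 from it ([canonical_map_range_far]).
    Let s_0, s_1, ... be dense in X.  By Helly's theorem
    ([exists_gt_on_kernels], a finite-codimensional Hahn-Banach theorem),
    the sets
      C_n = { v in M : |v| <= 1, F v = t, v s_i = 0 for all i < n }
    are nonempty.  They are convex and decreasing, they stay away from 0
    because F is bounded, and any g_n in C_n tend to 0 pointwise on X.
    James' selection ([James_selection]) picks g_n in C_n so that
    h = sum_n 2^-(n+1) g_n has partial sums of norm less than |h| - 2^-n d/2,
    for d > 0 a lower bound of the norm on C_0.  If h attained its norm, at x
    say, then |g_n x| <= d/2 for n large, the tail of the series would
    contribute at most 2^-n d/2 to h x, and |h x| < |h| would follow, the bound
    on the partial sums being strict.  But M is complete, so h is in M and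
    attains its norm: a contradiction.

    The argument takes place in real spaces.  A complex M is seen as a real
    normed space on which f acts by v |-> Re (f v); nothing is lost, because
    multiplying a vector by a unimodular scalar turns |f v| into a value of
    Re f. *)

Set Implicit Arguments.
Unset Strict Implicit.
Unset Printing Implicit Defensive.

Import Order.TTheory GRing.Theory Num.Theory.
Import numFieldNormedType.Exports.

Local Open Scope classical_set_scope.
Local Open Scope ring_scope.

(** * Geometric series and James' selection *)

(** Completeness in the only form that the proof uses: sequences whose steps
    are dominated by a geometric series converge, with the matching rate.  In
    this form it passes directly to duals, to closed subspaces and to the
    underlying real space. *)
Definition geometrically_complete (K : numFieldType) (V : normedModType K) :=
  forall (c : K) (z : nat -> V), 0 <= c ->
    (forall n, `|z n.+1 - z n| <= c * 2^-1 ^+ n.+1) ->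
  exists l, forall n, `|l - z n| <= c * 2^-1 ^+ n.

Lemma le_add_half_pow (R : realType) (a b : R) :
  (forall n, a <= b + 2^-1 ^+ n) -> a <= b.
Proof.
move=> ab; rewrite leNgt; apply/negP => ba.
have ba0 : 0 < a - b by rewrite subr_gt0.
have [n] : exists n, 2^-1 ^+ n < a - b.
  pose n := (Num.truncn (a - b)^-1).+1; exists n.
  have an : (a - b)^-1 < n%:R by exact: truncnS_gt.
  have nn : n%:R < 2 ^+ n :> R by rewrite -natrX ltr_nat ltn_expl.
  rewrite exprVn -ltf_pV2 ?posrE ?invr_gt0 ?exprn_gt0// invrK.
  exact: lt_trans nn.
by have := ab n; lra.
Qed.

(** With S_n = sum_(j < n) 2^-(j+1) g_j, choose g_n in C_n almost minimizing
    |S_n + 2^-n g|.  All later sums S_q + 2^-q g_q, and so h itself, arise from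
    such competitors, hence |S_n + 2^-n g_n| <= |h| up to a tiny error; as
    S_(n+1) is the midpoint of S_n and S_n + 2^-n g_n, the deficit
    |h| - |S_n| is at most halved at each step, so it stays above 2^-n d/2.
    A functional b bounded by the norm and at most d/2 on the late g_n cannot
    make up for that deficit on the tail of the series. *)
Lemma James_selection (R : realType) (V : normedModType R)
    (C : nat -> set V) (d : R) :
    geometrically_complete V -> 0 < d ->
    (forall n, C n !=set0) -> (forall n, C n.+1 `<=` C n) ->
    (forall n v w, C n v -> C n w -> C n (2^-1 *: (v + w))) ->
    (forall v, C 0%N v -> d <= `|v| <= 1) ->
  exists (g : nat -> V) (h : V), (forall n, C n (g n)) /\
    forall b : {scalar V}, (forall v, b v <= `|v|) ->
      (exists m, forall n, (m <= n)%N -> b (g n) <= d / 2) -> b h < `|h|.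
Proof.
move=> cV d0 C0 CS Cmid Cd.
have Cdec m n : (m <= n)%N -> C n `<=` C m.
  elim: n => [|n IH]; first by rewrite leqn0 => /eqP->.
  by rewrite leq_eqVlt => /predU1P[->//|/IH]; apply: subset_trans; exact: CS.
have /choice[pick pickP] : forall ns : nat * V, exists v,
    C ns.1 v /\ forall g, C ns.1 g ->
      `|ns.2 + 2^-1 ^+ ns.1 *: v|
        <= `|ns.2 + 2^-1 ^+ ns.1 *: g| + d / 4 * (2^-1 ^+ ns.1) ^+ 2.
  move=> [n s] /=.
  pose A := [set `|s + 2^-1 ^+ n *: g| | g in C n].
  have infA : has_inf A.
    split; first by have [g Cg] := C0 n; exists `|s + 2^-1 ^+ n *: g|, g.
    by exists 0 => _ [g _ <-].
  have e0 : 0 < d / 4 * (2^-1 ^+ n) ^+ 2.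
    by rewrite !(mulr_gt0, exprn_gt0, invr_gt0).
  have [_ [g Cg <-] gA] := inf_adherent e0 infA.
  exists g; split=> // g' Cg'; apply: le_trans (ltW gA) _; rewrite lerD2r.
  by apply: ge_inf; [exact: infA.2|exists g'].
pose S := fix S n : V :=
  if n is m.+1 then S m + 2^-1 ^+ m.+1 *: pick (m, S m) else 0.
pose g n := pick (n, S n).
have Cg n : C n (g n) by exact: (pickP (n, S n)).1.
have g1 n : `|g n| <= 1.
  by have /andP[] := Cd _ (Cdec 0%N n (leq0n n) _ (Cg n)).
have SS n : S n.+1 = S n + 2^-1 ^+ n.+1 *: g n by [].
have T0 n : 0 < 2^-1 ^+ n :> R by rewrite exprn_gt0 ?invr_gt0.
have [|h] := cV 1 S ler01.
  move=> n; rewrite SS addrC addKr mul1r normrZ gtr0_norm//.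
  by rewrite ler_piMr// ltW.
move=> hS1; have {hS1}hS n : `|h - S n| <= 2^-1 ^+ n.
  by have := hS1 n; rewrite mul1r.
exists g, h; split=> // b bV [m bg].
(* every later S_n + 2^-n g is of the form S_m + 2^-m g' *)
have pull p q v : (p <= q)%N -> C q v ->
    exists2 w, C p w & S q + 2^-1 ^+ q *: v = S p + 2^-1 ^+ p *: w.
  move=> pq; elim: q pq v => [|q IH].
    by rewrite leqn0 => /eqP-> v; exists v.
  rewrite leq_eqVlt => /predU1P[->|pq] v Cv; first by exists v.
  have [w Cw wE] := IH pq _ (Cmid q _ _ (Cg q) (CS _ _ Cv)).
  exists w => //; rewrite -wE SS scalerA -addrA -scalerDr; congr (_ + _ *: _).
  by rewrite exprSr.
pose z n := S n + 2^-1 ^+ n *: g n.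
have half n : 2^-1 ^+ n = 2^-1 ^+ n.+1 + 2^-1 ^+ n.+1 :> R.
  by rewrite exprS; lra.
have pow_le p q : (p <= q)%N -> 2^-1 ^+ q <= 2^-1 ^+ p :> R.
  by move=> pq; rewrite ler_wiXn2l//; lra.
have zh p q : (p < q)%N -> `|z q| <= `|h| + 2^-1 ^+ p.
  move=> /pow_le qp; have -> : z q = h - (h - S q) + 2^-1 ^+ q *: g q.
    by rewrite opprB addrCA subrr addr0.
  rewrite (le_trans (ler_normD _ _))//.
  rewrite (le_trans (lerD (ler_normB _ _) (lexx _)))// -addrA lerD2l (half p).
  rewrite lerD ?(le_trans (hS _))// normrZ gtr0_norm// (le_trans _ qp)//.
  by rewrite ler_piMr// ltW.
have hz n : `|z n| <= `|h| + d / 4 * (2^-1 ^+ n) ^+ 2.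
  apply: le_add_half_pow => p.
  have [w Cw wE] := pull n (maxn n p.+1) _ (leq_maxl _ _) (Cg _).
  apply: le_trans ((pickP (n, S n)).2 w Cw) _; rewrite /= -wE.
  by rewrite addrAC lerD2r zh// leq_maxr.
have dh : d <= `|h|.
  apply: le_add_half_pow => p.
  have [w Cw wE] := pull 0%N p.+1 _ (leq0n _) (Cg _).
  have /andP[dw _] := Cd _ Cw; apply: le_trans dw _.
  by move: wE; rewrite /= add0r expr0 scale1r => <-; exact: zh (ltnSn p).
(* the quadratic term absorbs the errors of the choices of the g_n *)
have Sh n : `|S n| <= `|h| - 2^-1 ^+ n * (`|h| - d / 2)
                      - d / 2 * (2^-1 ^+ n) ^+ 2.
  elim: n => [|n IH]; first by rewrite /= normr0 expr0; lra.
  have -> : S n.+1 = 2^-1 *: S n + 2^-1 *: z n.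
    rewrite SS /z [in RHS]scalerDr addrA -scalerDl.
    have -> : 2^-1 + 2^-1 = 1 :> R by lra.
    by rewrite scale1r scalerA -exprS.
  rewrite (le_trans (ler_normD _ _))// !normrZ !gtr0_norm ?invr_gt0//.
  by have := hz n; move: IH; rewrite (exprS _ n); lra.
have bS n : b (S (m + n)%N) - b (S m) <= d / 2 * (2^-1 ^+ m - 2^-1 ^+ (m + n)).
  elim: n => [|n IH]; first by rewrite addn0 !subrr mulr0.
  rewrite addnS SS linearD linearZ /= (exprS _ (m + n)).
  have := ler_wpM2l (ltW (T0 (m + n)%N)) (bg _ (leq_addr n m)).
  move: IH; move: (b _) (b (S m)) (b _) => x y w; lra.
suff : b h <= `|S m| + d / 2 * 2^-1 ^+ m.
  have := Sh m; have := mulr_gt0 d0 (exprn_gt0 2 (T0 m)).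
  have := ler_wpM2l (ltW (T0 m)) dh; rewrite expr2; move: (b h) => x; lra.
apply: le_add_half_pow => n.
have : b h - b (S (m + n)%N) <= 2^-1 ^+ (m + n).
  by rewrite -linearB; exact: le_trans (bV _) (hS _).
have := pow_le _ _ (leq_addl m n).
have := bS n; have := T0 (m + n)%N; have := bV (S m).
have := mulr_gt0 d0 (T0 (m + n)%N); move: (b _) (b _) (b _) => x y w; lra.
Qed.

(** * Helly's theorem *)

Section Helly.
Context (R : realType) (V : normedModType R).

(** One step of the Hahn-Banach theorem, read on the dual side.  For v, w in E
    with u v = 1 and u w = -1, the sum v + w is in the kernel of u, so
    G v - t |v| <= t |w| - G w: any c separating the two sides will do. *)
Lemma bound_off_kernel (E : set V) (G u : {scalar V}) (t : R) :
    0 <= t -> (forall a v w, E v -> E w -> E (a *: v + w)) ->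
    (forall v, E v -> u v = 0 -> G v <= t * `|v|) ->
  exists c, forall v, E v -> G v - c * u v <= t * `|v|.
Proof.
move=> t0 Elin Gt.
have E0 v : E v -> E 0 by move=> Ev; rewrite -(addNr v) -scaleN1r; exact: Elin.
have EZ a v : E v -> E (a *: v).
  by move=> Ev; rewrite -[_ *: _]addr0; apply: Elin => //; exact: E0 Ev.
have [[v0 [Ev0 uv0]]|u0] := pselect (exists v, E v /\ u v != 0); last first.
  exists 0 => v Ev; rewrite mul0r subr0; apply: Gt => //.
  by apply/eqP/negP => /negP uv; apply: u0; exists v.
pose A := [set G v - t * `|v| | v in [set v | E v /\ u v = 1]].
have Aub w : E w -> u w = -1 -> ubound A (t * `|w| - G w).
  move=> Ew uw _ [v [Ev uv] <-].
  have := Gt (1 *: v + w) (Elin _ _ _ Ev Ew).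
  rewrite scale1r !linearD uv uw subrr => /(_ erefl).
  have := ler_wpM2l t0 (ler_normD v w).
  by move: (G v) (G w) => x y; lra.
have A0 : A !=set0.
  exists (G ((u v0)^-1 *: v0) - t * `|(u v0)^-1 *: v0|).
  exists ((u v0)^-1 *: v0) => //.
  by split; [exact: EZ|rewrite linearZ /= mulVf].
have Abd : has_ubound A.
  exists (t * `|- (u v0)^-1 *: v0| - G (- (u v0)^-1 *: v0)); apply: Aub.
    exact: EZ.
  by rewrite linearZ /= mulNr mulVf.
(* rescaling reduces the three signs of u v to u v = 1, -1 and 0 *)
exists (sup A) => v Ev.
have [uv_sgn|uv_sgn|uv_sgn] := ltgtP (u v) 0.
- have k0 : 0 < (- u v)^-1 by rewrite invr_gt0 oppr_gt0.
  have uk : u ((- u v)^-1 *: v) = -1.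
    by rewrite linearZ /= invrN mulNr mulVf ?lt_eqF.
  have := ge_sup A0 (Aub _ (EZ _ _ Ev) uk).
  rewrite linearZ /= normrZ (gtr0_norm k0) mulrCA -mulrBr.
  by rewrite ler_pdivlMl ?oppr_gt0//; move: (G v) (u v) => x y; lra.
- have : A (G ((u v)^-1 *: v) - t * `|(u v)^-1 *: v|).
    exists ((u v)^-1 *: v) => //; split; first exact: EZ.
    by rewrite linearZ /= mulVf ?gt_eqF.
  move=> /(ub_le_sup Abd); rewrite linearZ /= normrZ gtr0_norm ?invr_gt0//.
  by rewrite mulrCA -mulrBr ler_pdivrMl//; move: (G v) (u v) => x y; lra.
- by rewrite uv_sgn mulr0 subr0; exact: Gt.
Qed.

(** The norm of F on a joint kernel is its distance to the span of the U_i: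
    peel off the functionals one at a time. *)
Lemma bound_off_kernels (U : nat -> {scalar V}) (n : nat) (F : {scalar V})
    (t : R) : 0 <= t ->
    (forall v, (forall i, (i < n)%N -> U i v = 0) -> F v <= t * `|v|) ->
  exists c : nat -> R, forall v, F v - \sum_(i < n) c i * U i v <= t * `|v|.
Proof.
move=> t0; elim: n F => [|n IH] F Ft.
  by exists (fun=> 0) => v; rewrite big_ord0 subr0; exact: Ft.
pose E : set V := [set v | forall i, (i < n)%N -> U i v = 0].
have [|v Ev Uv|c Fc] := @bound_off_kernel E F (U n) t t0.
- by move=> a v w Ev Ew i lt_in; rewrite linearP Ev// Ew// mulr0 addr0.
- by apply: Ft => i; rewrite ltnS leq_eqVlt => /predU1P[->//|]; exact: Ev.
pose F' v := F v - c * U n v.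
have F'lin : scalar F'.
  by move=> a v w; rewrite /F' !linearP /=; ring.
pose G : {scalar V} := HB.pack F' (GRing.isLinear.Build R V R *%R F' F'lin).
have [|c' Gc'] := IH G; first exact: Fc.
exists (fun i => if i == n then c else c' i) => v.
rewrite big_ord_recr /= eqxx; under eq_bigr do rewrite ltn_eqF//.
rewrite opprD addrA addrAC; exact: Gc'.
Qed.

Lemma exists_gt_on_kernels (U : nat -> {scalar V}) (n : nat) (F : {scalar V})
    (t : R) : 0 <= t ->
    (forall c : nat -> R,
      exists v, t * `|v| < F v - \sum_(i < n) c i * U i v) ->
  exists2 v, (forall i, (i < n)%N -> U i v = 0) & t * `|v| < F v.
Proof.
move=> t0 far; apply: contrapT => noV.
have [|c Fc] := @bound_off_kernels U n F t t0.
  by move=> v Uv; rewrite leNgt; apply/negP => vt; apply: noV; exists v.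
by have [v] := far c; rewrite ltNge Fc.
Qed.

End Helly.

(** * Functionals far from a separable family *)

(** James' theorem: if F is not in the closed span of the U_i, some vector
    attains its norm at no b of the unit ball that lies in the closure of the
    U_i.  Take C_n to be the part of the unit ball where F = t and
    U_0, ..., U_(n-1) vanish: if b is within e of U_i, then b is at most e
    on C_n for all n > i. *)
Lemma separable_family_not_attaining (R : realType) (V : normedModType R)
    (U : nat -> {scalar V}) (F : {scalar V}) (t B : R) :
    geometrically_complete V -> 0 < t -> (forall v, F v <= B * `|v|) ->
    (forall n (c : nat -> R),
      exists v, t * `|v| < F v - \sum_(i < n) c i * U i v) ->
  exists h, forall b : {scalar V}, (forall v, b v <= `|v|) ->
    (forall e, 0 < e -> exists i, forall v, b v <= U i v + e * `|v|) ->
    b h < `|h|.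
Proof.
move=> cV t0 FB far.
pose C n : set V :=
  [set v | [/\ `|v| <= 1, F v = t & forall i, (i < n)%N -> U i v = 0]].
have Cn0 n : C n !=set0.
  have [v Uv Fv] := exists_gt_on_kernels (ltW t0) (far n).
  have Fv0 : 0 < F v by apply: le_lt_trans Fv; rewrite mulr_ge0// ltW.
  exists ((t / F v) *: v); split.
  - rewrite normrZ gtr0_norm ?divr_gt0// mulrAC ler_pdivrMr// mul1r.
    exact: ltW.
  - by rewrite linearZ /= divfK ?gt_eqF.
  - by move=> i /Uv Uv0; rewrite linearZ /= Uv0 mulr0.
have B0 : 0 < B.
  have [v [v1 Fv _]] := Cn0 0%N; have := FB v; rewrite Fv => tB.
  have : 0 < B * `|v| by exact: lt_le_trans tB.
  by have := normr_ge0 v; nra.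
have [|||||g [h [Cg hb]]] := James_selection (C := C) (d := t / B) cV.
- exact: divr_gt0.
- exact: Cn0.
- by move=> n v [v1 Fv Uv]; split=> // i lt_in; exact/Uv/ltnW.
- move=> n v w [v1 Fv Uv] [w1 Fw Uw]; split.
  + rewrite normrZ gtr0_norm ?invr_gt0//.
    by have := ler_normD v w; lra.
  + by rewrite linearZ linearD /= Fv Fw; lra.
  + by move=> i lt_in; rewrite linearZ linearD /= Uv// Uw// addr0 mulr0.
- move=> v [v1 Fv _]; rewrite v1 andbT ler_pdivrMr// mulrC -Fv; exact: FB.
exists h => b bV bU; apply: hb => //.
have [|i bi] := bU (t / B / 2); first by rewrite !divr_gt0.
exists i.+1 => n lt_in; have [g1 _ Ug] := Cg n.
rewrite (le_trans (bi _))// Ug// add0r ler_piMr//.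
by rewrite ltW// !divr_gt0.
Qed.

(** * Real and complex scalars *)

Section Scalars.
Context (R : realType) (k : scalar_kind).
Local Notation K := (scalars R k).

(** With [of_real] and [re], both scalar fields are handled by the same proofs:
    norms are real, so they are compared through their real parts. *)
Definition of_real : R -> K :=
  match k return R -> scalars R k with
  | RealScalars => id
  | ComplexScalars => real_complex R
  end.

Definition re : K -> R :=
  match k return scalars R k -> R with
  | RealScalars => id
  | ComplexScalars => @complex.Re R
  end.

Fact of_real_additive : zmod_morphism of_real.
Proof. by rewrite /of_real; case: k => // a b; rewrite raddfB. Qed.

Fact of_real_multiplicative : monoid_morphism of_real.
Proof.
rewrite /of_real; case: k => //; split; first exact: rmorph1.
by move=> a b; rewrite rmorphM.
Qed.

HB.instance Definition _ :=
  GRing.isZmodMorphism.Build R K of_real of_real_additive.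
HB.instance Definition _ :=
  GRing.isMonoidMorphism.Build R K of_real of_real_multiplicative.

Fact re_additive : zmod_morphism re.
Proof. by rewrite /re; case: k => //= -[a b] [c d]. Qed.

HB.instance Definition _ := GRing.isZmodMorphism.Build K R re re_additive.

Lemma of_realK : cancel of_real re.
Proof. by rewrite /of_real /re; case: k. Qed.

Lemma reM a z : re (of_real a * z) = a * re z.
Proof.
rewrite /of_real /re; move: z; case: k => //= -[x y] /=.
by rewrite mul0r subr0.
Qed.

Lemma reK z : 0 <= z -> of_real (re z) = z.
Proof.
rewrite /of_real /re; move: z; case: k => //= z.
by move=> /ger0_real; exact: RRe_real.
Qed.

Lemma ler_of_real a b : (of_real a <= of_real b) = (a <= b).
Proof. by rewrite /of_real; case: k => //=; rewrite lecR. Qed.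

Lemma ler_re x y : x <= y -> re x <= re y.
Proof.
by rewrite /re; move: x y; case: k => //= x y; rewrite lecE => /andP[].
Qed.

Lemma ltr_of_real a b : (of_real a < of_real b) = (a < b).
Proof. by rewrite /of_real; case: k => //=; rewrite ltcR. Qed.

Lemma normr_of_real a : `|of_real a| = of_real `|a|.
Proof.
rewrite /of_real; case: k => //=.
apply: etrans (normc_def _) _.
by rewrite /= expr0n addr0 sqrtr_sqr.
Qed.

Lemma normr_re z : `|re z| <= re `|z|.
Proof.
rewrite /re; move: z; case: k => //= z.
have := congr1 (@complex.Re R) (normc_def z) => /= nz.
apply: le_trans (_ : _ <= Num.sqrt (complex.Re z ^+ 2 + complex.Im z ^+ 2)) _.
  by rewrite -sqrtr_sqr ler_wsqrtr// lerDl sqr_ge0.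
by rewrite -nz.
Qed.

Lemma exists_unimodular (z : K) : exists u : K, `|u| = 1 /\ u * z = `|z|.
Proof.
have [->|z0] := eqVneq z 0; first by exists 1; rewrite normr1 mulr0 normr0.
exists (`|z| / z); rewrite divfK// normrM normfV normr_id divff//.
by rewrite normr_eq0.
Qed.

Lemma pow_half_of_real n : 2^-1 ^+ n = of_real (2^-1 ^+ n).
Proof. by rewrite rmorphXn fmorphV rmorph_nat. Qed.

Lemma exists_pow_half_lt (e : K) : 0 < e -> exists n, 2^-1 ^+ n < e.
Proof.
move=> e0; have := reK (ltW e0); move: (re e) => r rE.
have r0 : 0 < r by rewrite -ltr_of_real rE rmorph0.
have [n nr] : exists n, 2^-1 ^+ n < r.
  apply: contrapT => nn; suff : r <= 0 by rewrite leNgt r0.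
  apply: le_add_half_pow => n; rewrite add0r leNgt; apply/negP => nr.
  by apply: nn; exists n.
by exists n; rewrite -rE pow_half_of_real ltr_of_real.
Qed.

Lemma norm_sub_le_geometric (V : normedModType K) (c : K) (z : nat -> V) m n :
    (forall n, `|z n.+1 - z n| <= c * 2^-1 ^+ n.+1) -> (n <= m)%N ->
  `|z m - z n| <= c * 2^-1 ^+ n - c * 2^-1 ^+ m.
Proof.
move=> zc; elim: m => [|m IH].
  by rewrite leqn0 => /eqP->; rewrite !subrr normr0.
rewrite leq_eqVlt => /predU1P[->|/IH {}IH]; first by rewrite !subrr normr0.
rewrite -(subrKA (z m)) (le_trans (ler_normD _ _))//.
rewrite (le_trans (lerD (zc m) IH))// addrCA lerD2l -(mulrN c) -mulrN -mulrDr.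
have -> : 2^-1 ^+ m = 2^-1 ^+ m.+1 + 2^-1 ^+ m.+1 :> K.
  by rewrite exprSr; exact: splitr.
by rewrite opprD addNKr.
Qed.

Lemma le_add_mul_half_pow (c x y : K) : 0 <= c -> 0 <= x -> 0 <= y ->
  (forall n, x <= y + c * 2^-1 ^+ n) -> x <= y.
Proof.
move=> c0 x0 y0 xy; rewrite -(reK x0) -(reK y0) ler_of_real.
have {}xy n : re x <= re y + re c * 2^-1 ^+ n.
  by rewrite -ler_of_real rmorphD rmorphM /= !reK// -pow_half_of_real.
have c0' : 0 <= re c by rewrite -ler_of_real rmorph0 reK.
rewrite -(@ler_pM2r _ (re c + 1)^-1) ?invr_gt0 ?ltr_wpDl//.
apply: le_add_half_pow => n.
rewrite ler_pdivrMr ?ltr_wpDl// mulrDl divfK ?gt_eqF ?ltr_wpDl//.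
rewrite (le_trans (xy n))// lerD2l mulrC ler_wpM2l ?exprn_ge0 ?invr_ge0//; lra.
Qed.

Lemma complete_geometrically_complete (V : completeNormedModType K) :
  geometrically_complete V.
Proof.
move=> c z c0 zc.
have tel := norm_sub_le_geometric zc.
have T0 n : 0 < 2^-1 ^+ n :> K by rewrite exprn_gt0 ?invr_gt0.
have : cvg (z @ \oo).
  apply: cauchy_cvg; apply: cauchy_exP => e e0.
  have [n cn] := exists_pow_half_lt (divr_gt0 e0 (ltr_wpDl c0 ltr01)).
  exists (z n); exists n => // m /= nm; rewrite -ball_normE /= distrC.
  apply: le_lt_trans (tel _ _ nm) _.
  rewrite (@le_lt_trans _ _ ((c + 1) * 2^-1 ^+ n))//.
    by rewrite lerBlDr mulrDl mul1r -addrA lerDl addr_ge0 ?mulr_ge0// ltW.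
  by rewrite mulrC -ltr_pdivlMr// ltr_wpDl.
move=> /cvg_ex[l zl]; exists l => n.
apply: (@le_add_mul_half_pow 1) => // [|p]; first by rewrite mulr_ge0// ltW.
rewrite mul1r; have /cvgrPdist_lt/(_ _ (T0 p))[N _ Nl] := zl.
have := Nl (maxn N n) (leq_maxl _ _); rewrite /= => /ltW lN.
rewrite -(subrKA (z (maxn N n))) (le_trans (ler_normD _ _))// addrC lerD//.
by rewrite (le_trans (tel _ _ (leq_maxr _ _)))// gerBl mulr_ge0// ltW.
Qed.

End Scalars.

(** In the complex case the real and imaginary parts converge separately; the
    rate of convergence for the modulus, lost by a factor 2 when the two parts
    are added, is recovered from that of the sequence itself. *)
Lemma scalars_geometrically_complete (R : realType) (k : scalar_kind) :
  geometrically_complete ((scalars R k)^o : normedModType (scalars R k)).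
Proof.
case: k; first exact: (@complete_geometrically_complete R RealScalars R).
move=> c z c0 zc.
have tel := norm_sub_le_geometric zc.
pose T n : R := 2^-1 ^+ n.
have TE n : 2^-1 ^+ n = (T n)%:C%C :> R[i].
  by rewrite (@pow_half_of_real R ComplexScalars).
have cE : (complex.Re c)%:C%C = c by exact: (@reK R ComplexScalars).
have part (f : R[i] -> R) : (forall x y, f (x - y) = f x - f y) ->
    (forall x, `|f x| <= complex.Re `|x|) ->
    exists a, forall n, `|a - f (z n)| <= complex.Re c * T n.
  move=> fB fle; apply: (@complete_geometrically_complete R RealScalars R).
    by rewrite -(@ler_of_real R ComplexScalars) /= cE.
  move=> n; rewrite -fB; apply: le_trans (fle _) _.
  have := @ler_re R ComplexScalars _ _ (zc n).
  rewrite (@pow_half_of_real R ComplexScalars) [c * _]mulrC reM.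
  by rewrite [_ * re _]mulrC.
have [a az] :=
  part _ (@raddfB _ _ (@complex.Re R)) (@normr_re R ComplexScalars).
have [|x|b bz] := part (@complex.Im R).
- by move=> [x1 x2] [y1 y2].
- by rewrite normc_def /= -sqrtr_sqr ler_wsqrtr// lerDr sqr_ge0.
exists (a +i* b)%C => n.
(* z q, for q large, serves as a stand-in for the limit *)
apply: (@le_add_mul_half_pow R ComplexScalars (c + c)).
- by rewrite addr_ge0.
- exact: normr_ge0.
- by rewrite mulr_ge0// exprn_ge0 ?invr_ge0.
move=> p; set q := maxn n p.
rewrite -(subrKA (z q)) (le_trans (ler_normD _ _))// addrC lerD//.
  rewrite (le_trans (tel _ _ (leq_maxl _ _)))// gerBl mulr_ge0//.
  by rewrite exprn_ge0 ?invr_ge0.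
have -> : (a +i* b)%C - z q =
    (a - complex.Re (z q))%:C%C + 'i%C * (b - complex.Im (z q))%:C%C :> R[i].
  by case: (z q) => x y; exact: (complexE (Complex (a - x) (b - y))).
rewrite (le_trans (ler_normD _ _))// [X in _ + X]normrM.
have -> : `|'i%C : R[i]| = 1.
  by rewrite normc_def /= expr0n expr1n add0r sqrtr1.
rewrite mul1r mulrDl.
have small t : `|t| <= complex.Re c * T q ->
    `|(t%:C)%C : R[i]| <= c * 2^-1 ^+ p.
  move=> tT.
  apply: (@le_trans _ _ (c * (T q)%:C%C)).
    by rewrite -cE -rmorphM (@normr_of_real R ComplexScalars) lecR.
  rewrite TE ler_wpM2l// lecR ler_wiXn2l ?leq_maxr//; lra.
by apply: lerD; apply: small; [exact: az|exact: bz].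
Qed.

(** * Completeness of duals and of closed subspaces *)

Section Completeness.
Context (R : realType) (k : scalar_kind).
Local Notation K := (scalars R k).

Lemma dual_funB (X : normedModType K) (f g : dual X) (x : X) :
  (f - g) x = f x - g x.
Proof. by rewrite -scaleN1r addrC dual_funP scaleN1r addrC. Qed.

Lemma bounded_linear_in_dual (X : normedModType K) (f : X -> K^o) (r : K) :
  linear f -> (forall x, `|f x| <= r * `|x|) ->
  f \in continuous_linear (X := X).
Proof.
move=> lf fr; apply/continuous_linearP; split=> //.
pose g : {linear X -> K^o} :=
  HB.pack f (GRing.isLinear.Build K X K^o *:%R f lf).
apply: (bounded_linear_continuous (f := g)); apply/linear_boundedP.
have r0 : `|r| \is Num.real by exact: normr_real.
near=> s.
have rs : `|r| <= s by near: s; exact: nbhs_pinfty_ge.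
move=> x /=; have [->|x0] := eqVneq x 0.
  by rewrite [f 0](linear0 g) !normr0 mulr0.
rewrite (le_trans (fr x))// ler_wpM2r// (le_trans _ rs)// real_ler_norm//.
have := le_trans (normr_ge0 _) (fr x).
by rewrite pmulr_lge0 ?normr_gt0// => /ger0_real.
Unshelve. all: by end_near. Qed.

(** The pointwise limit of the f n is linear, since its defect of linearity is
    bounded by a multiple of 2^-n for every n, and it is within c 2^-n of f n
    on the unit ball. *)
Lemma dual_geometrically_complete (X : normedModType K) :
  geometrically_complete (dual X).
Proof.
move=> c f c0 fc.
have T0 n : 0 <= 2^-1 ^+ n :> K by rewrite exprn_ge0 ?invr_ge0.
have /choice[l lf] : forall x, exists y : K^o,
    forall n, `|y - f n x| <= c * `|x| * 2^-1 ^+ n.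
  move=> x; apply: scalars_geometrically_complete; first exact: mulr_ge0.
  move=> n; have := ler_wpM2r (normr_ge0 x) (fc n).
  move=> /(le_trans (le_dual_norm (f n.+1 - f n) x)).
  by rewrite mulrAC dual_funB.
have llin : linear l.
  move=> a x y; apply/eqP; rewrite -subr_eq0 -normr_le0.
  apply: (@le_add_mul_half_pow R k
    (c * `|a *: x + y| + `|a| * (c * `|x|) + c * `|y|)) => // [|n].
    by rewrite !addr_ge0 ?mulr_ge0.
  rewrite add0r.
  have -> : l (a *: x + y) - (a *: l x + l y) =
      (l (a *: x + y) - f n (a *: x + y)) - a *: (l x - f n x) - (l y - f n y).
    have aux (b u v w v' w' : K) :
        u - (b * v + w) = u - (b * v' + w') - b * (v - v') - (w - w') by ring.
    by rewrite (dual_linear (f n)); exact: aux.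
  rewrite (le_trans (ler_normB _ _))// mulrDl lerD//.
  rewrite (le_trans (ler_normB _ _))// mulrDl lerD//.
  by rewrite normrZ -mulrA ler_wpM2l.
have lb x : `|l x| <= (c + dual_norm (f 0%N)) * `|x|.
  rewrite -(subrK (f 0%N x) (l x)) (le_trans (ler_normD _ _))// mulrDl lerD//.
    by have := lf x 0%N; rewrite expr0 mulr1.
  exact: le_dual_norm.
exists (Dual (bounded_linear_in_dual llin lb)) => n.
apply: dual_norm_le => x x1.
by rewrite dual_funB (le_trans (lf x n))// mulrAC ler_piMr// mulr_ge0.
Qed.

Lemma closed_submod_geometrically_complete (V : normedModType K)
    (M : submodClosed V) :
  geometrically_complete V -> closed [set v | v \in M] ->
  geometrically_complete (submod_space M).
Proof.
move=> cV clM c z c0 zc.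
have normB (v w : submod_space M) :
    `|v - w| = `|submod_val v - submod_val w|.
  by rewrite -[submod_val v - _](raddfB (val : submod_space M -> V)).
have [|l lz] := cV c (fun n => submod_val (z n)) c0.
  by move=> n; rewrite -normB.
have Ml : l \in M.
  apply: (clM l) => B /nbhs_ballP[e /= e0 eB].
  have [n cn] := exists_pow_half_lt (divr_gt0 e0 (ltr_wpDl c0 ltr01)).
  exists (submod_val (z n)); split; first exact: valP.
  apply: eB; rewrite -ball_normE /=; apply: le_lt_trans (lz n) _.
  rewrite (@le_lt_trans _ _ ((c + 1) * 2^-1 ^+ n))//.
    by rewrite ler_wpM2r ?lerDl// exprn_ge0 ?invr_ge0.
  by rewrite mulrC -ltr_pdivlMr// ltr_wpDl.
exists (SubmodSpace Ml) => n.
by rewrite normB; exact: lz.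
Qed.

End Completeness.

(** * The canonical map is isometric *)

Section Isometry.
Context (R : realType) (k : scalar_kind).
Local Notation K := (scalars R k).

(** The infimum is the supremum of the nonnegative lower bounds.  Every lower
    bound b of a set of nonnegative reals is a real, so that it can be compared
    with 0 even when the scalars are complex. *)
Lemma scalars_infimums (A : set K) : A !=set0 -> (forall a, A a -> 0 <= a) ->
  infimums A !=set0.
Proof.
move=> [a Aa] A0; have Alb0 : lbound A 0 by move=> b /A0.
pose B := [set b | 0 <= b /\ lbound A b].
have [|b []//||s [sB Bs]] := @scalars_supremums R k B.
- by exists 0.
- by exists a => b [_ /(_ _ Aa)].
have s0 : 0 <= s by exact: sB.
exists s; split=> [b Ab|b bA]; first by apply: Bs => c [_ /(_ _ Ab)].
have : b \is Num.real by rewrite (ler_real (bA _ Aa)) ger0_real// A0.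
case/orP => [b0|b0]; first exact: sB.
exact: le_trans s0.
Qed.

Lemma ge_infimum (A : set K) (x0 a : K) : (forall a, A a -> 0 <= a) -> A a ->
  infimum x0 A <= a.
Proof.
move=> A0 Aa; have [|i iA] := scalars_infimums _ A0; first by exists a.
rewrite /infimum ifF; last by apply/negbTE/set0P; exists a.
by case: xgetP => [y _ [+ _]|/(_ i)//]; apply.
Qed.

Lemma supremum_is_lub (A : set K) (x0 u : K) : A !=set0 ->
  (forall a, A a -> 0 <= a) -> ubound A u -> supremums A (supremum x0 A).
Proof.
move=> An A0 Au; have [|s As] := scalars_supremums An A0; first by exists u.
rewrite /supremum ifF; last exact/negbTE/set0P.
by case: xgetP => [//|/(_ s)].
Qed.

Context (X : normedModType K) (M : submodClosed (dual X)).

Fact canonical_map_linear : linear (@canonical_map R k X M).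
Proof.
move=> a x y; apply/val_inj/funext => f.
by rewrite [RHS]dual_funP /= /evaluation linearP.
Qed.

HB.instance Definition _ := GRing.isLinear.Build K X (dual (submod_space M))
  *:%R (@canonical_map R k X M) canonical_map_linear.

(** For |x| <= |Phi x|: the quotient |Phi x| / |x| bounds the ratios |f x| / |x|
    for f in the unit ball of M, whose supremum is at least the
    characteristic 1. *)
Lemma norm_canonical_map (x : X) : is_determinant M ->
  `|canonical_map M x| = `|x|.
Proof.
move=> detM; apply/eqP; rewrite eq_le; apply/andP; split.
  apply: dual_norm_le => f f1.
  rewrite (le_trans (le_dual_norm (submod_val f) x))//.
  by rewrite ler_piMl.
have [->|x0] := eqVneq x 0; first by rewrite normr0 normr_ge0.
pose S y := [set `|f y| / `|y| | f in [set f : dual X | f \in M /\ `|f| <= 1]].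
have S0 y : S y !=set0.
  by exists (`|(0 : dual X) y| / `|y|), 0 => //=; rewrite rpred0 normr0.
have Sge0 y a : S y a -> 0 <= a by move=> [f _ <-]; rewrite divr_ge0.
have Sle y : y != 0 -> ubound (S y) (`|canonical_map M y| / `|y|).
  move=> y0 _ [f [Mf f1] <-]; rewrite ler_pM2r ?invr_gt0 ?normr_gt0//.
  apply: le_trans (le_dual_norm (canonical_map M y) (SubmodSpace Mf)) _.
  by rewrite ler_piMr// dual_norm_ge0.
have Slub y : y != 0 -> supremums (S y) (supremum 0 (S y)).
  by move=> y0; apply: supremum_is_lub (Sle _ y0) => //; exact: Sge0.
have : 1 <= supremum 0 (S x).
  rewrite -detM; apply: ge_infimum; last by exists x.
  move=> _ [y y0 <-]; have [a Sa] := S0 y.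
  by apply: le_trans (Sge0 _ _ Sa) _; apply: (Slub y y0).1.
move=> /le_trans/(_ ((Slub x x0).2 _ (Sle x x0))).
by rewrite ler_pdivlMr ?normr_gt0// mul1r.
Qed.

End Isometry.

(** * The underlying real normed space *)

Section Realification.
Context (R : realType) (k : scalar_kind).
Local Notation K := (scalars R k).
Context (V : normedModType K).

(** A copy of V, so that it can carry the real scaling and the real-valued norm
    beside the structure of V. *)
Definition realification : Type := V.

HB.instance Definition _ := GRing.Zmodule.on realification.

Definition real_scale (a : R) (v : realification) : realification :=
  (of_real k a *: (v : V)).

Fact real_scaleA a b v : real_scale a (real_scale b v) = real_scale (a * b) v.
Proof. by rewrite /real_scale scalerA rmorphM. Qed.

Fact real_scale1 : left_id 1 real_scale.
Proof. by move=> v; rewrite /real_scale rmorph1 scale1r. Qed.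

Fact real_scaleDr : right_distributive real_scale +%R.
Proof. by move=> a v w; rewrite /real_scale scalerDr. Qed.

Fact real_scaleDl v : {morph real_scale^~ v : a b / a + b}.
Proof. by move=> a b; rewrite /real_scale rmorphD scalerDl. Qed.

HB.instance Definition _ := GRing.Zmodule_isLmodule.Build R realification
  real_scaleA real_scale1 real_scaleDr real_scaleDl.

Definition real_norm (v : realification) : R := re `|v : V|.

Fact real_normD v w : real_norm (v + w) <= real_norm v + real_norm w.
Proof. by rewrite /real_norm -raddfD; apply: ler_re; exact: ler_normD. Qed.

Fact real_normZ a v : real_norm (a *: v) = `|a| * real_norm v.
Proof. by rewrite /real_norm normrZ normr_of_real reM. Qed.

Fact real_norm0_eq0 v : real_norm v = 0 -> v = 0.
Proof.
move=> v0; apply: (@normr0_eq0 _ V).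
by rewrite -[LHS]reK// [re _]v0 rmorph0.
Qed.

HB.instance Definition _ := Lmodule_isNormed.Build R realification
  real_normD real_normZ real_norm0_eq0.

Lemma realification_geometrically_complete :
  geometrically_complete V -> geometrically_complete realification.
Proof.
move=> cV c z c0 zc.
have [||l lz] := cV (of_real k c) z.
- by rewrite -(rmorph0 (of_real k)) ler_of_real.
- move=> n; rewrite -[leLHS]reK// pow_half_of_real -rmorphM ler_of_real.
  exact: zc.
exists l => n; rewrite -(ler_of_real k) rmorphM /= -pow_half_of_real.
by rewrite [X in X <= _]reK//; exact: lz.
Qed.

Definition re_functional (f : dual V) (v : realification) : R := re (f v).

Fact re_functional_scalar (f : dual V) : scalar (re_functional f).
Proof.
move=> a v w; rewrite /re_functional.
by rewrite [f _](dual_linear f (of_real k a) v w) raddfD /= reM.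
Qed.

HB.instance Definition _ (f : dual V) :=
  GRing.isLinear.Build R realification R *%R (re_functional f)
    (re_functional_scalar f).

Lemma le_re_functional (f : dual V) (v : realification) :
  re_functional f v <= re `|f| * `|v|.
Proof.
apply: le_trans (ler_norm _) _; apply: le_trans (normr_re _) _.
rewrite -reM reK//; apply: ler_re; exact: le_dual_norm.
Qed.

(** Rotating v by a unimodular scalar makes f v real and nonnegative, so real
    parts are enough to compute the norm of f. *)
Lemma exists_re_functional_gt (f : dual V) (t : R) : 0 <= t ->
  ~ `|f| <= of_real k t ->
  exists v : realification, t * `|v| < re_functional f v.
Proof.
move=> t0 ft.
have [v [v1 fv]] : exists v, `|v| <= 1 /\ t < re `|f v|.
  apply: contrapT => noV; apply: ft; apply: dual_norm_le => v v1.
  rewrite -[leLHS]reK// ler_of_real leNgt; apply/negP => tv.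
  by apply: noV; exists v.
have [u [u1 uf]] := exists_unimodular (f v).
exists (u *: v); have fuv : f (u *: v) = `|f v| by rewrite linearZ; exact: uf.
rewrite /re_functional fuv.
apply: le_lt_trans fv; rewrite ler_piMr// [`|_|]/(re `|u *: v|).
by rewrite normrZ u1 mul1r -(of_realK k 1) ler_re// rmorph1.
Qed.

End Realification.

Lemma dense_sequence (R : realType) (k : scalar_kind)
    (X : normedModType (scalars R k)) : is_separable X ->
  exists s : nat -> X, forall x (e : R), 0 < e ->
    exists i, re `|x - s i| <= e.
Proof.
move=> [D [/countable_injP[f finj] dD]].
have /choice[s sP] : forall n, exists x, forall y, D y -> f y = n -> x = y.
  (* s inverts on its range the injection f of D into nat *)
  move=> n; have [[y [Dy yn]]|no] := pselect (exists y, D y /\ f y = n).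
    by exists y => y' Dy' yn'; apply: finj; rewrite ?inE// yn yn'.
  by exists 0 => y Dy yn; case: no; exists y.
exists s => x e e0.
have ek0 : 0 < of_real k e by rewrite -(rmorph0 (of_real k)) ltr_of_real.
have [||y [xy Dy]] := dD (ball x (of_real k e)).
- by exists x; exact: ballxx.
- exact: ball_open.
exists (f y); rewrite (sP _ _ Dy erefl) -(of_realK k e); apply: ler_re.
by move: xy; rewrite -ball_normE => /ltW.
Qed.

(** * The canonical map is onto *)

Section Surjectivity.
Context (R : realType) (k : scalar_kind).
Local Notation K := (scalars R k).
Context (X : completeNormedModType K) (M : submodClosed (dual X)).
Local Notation Phi := (@canonical_map R k X M).

(** The range of Phi is closed: if the Phi (z n) approach F geometrically then,
    Phi being isometric, so do the z n approach some x, and F = Phi x. *)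
Lemma canonical_map_range_far (F : dual (submod_space M)) :
  is_determinant M -> (forall x, F <> Phi x) ->
  exists2 t : R, 0 < t & forall x, ~ `|F - Phi x| <= of_real k t.
Proof.
move=> detM noF; apply: contrapT => near.
have /choice[z zP] : forall n, exists x, `|F - Phi x| <= 2^-1 ^+ n.
  move=> n; apply: contrapT => nox; apply: near; exists (2^-1 ^+ n).
    by rewrite exprn_gt0 ?invr_gt0.
  by move=> x xn; apply: nox; exists x; rewrite pow_half_of_real.
have T2 n : 2^-1 ^+ n = 2^-1 ^+ n.+1 + 2^-1 ^+ n.+1 :> K.
  by rewrite exprSr; exact: splitr.
have T0 n : 0 <= 2^-1 ^+ n :> K by rewrite exprn_ge0 ?invr_ge0.
have [||x xz] := @complete_geometrically_complete R k X 3 z.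
- by [].
- move=> n; rewrite -(norm_canonical_map _ detM) linearB /=.
  rewrite -(subrKA F) (le_trans (ler_normD _ _))// distrC.
  rewrite (le_trans (lerD (zP _) (zP _)))// (T2 n).
  move: (2^-1 ^+ n.+1) => r.
  by rewrite le_eqVlt; apply/orP; left; apply/eqP; ring.
apply: (noF x); apply/eqP; rewrite -subr_eq0 -normr_le0.
apply: (@le_add_mul_half_pow R k 4) => // n; rewrite add0r.
rewrite -(subrKA (Phi (z n))) (le_trans (ler_normD _ _))//.
rewrite -linearB /= (norm_canonical_map _ detM) [`|z n - x|]distrC.
rewrite (le_trans (lerD (zP n) (xz n)))//.
move: (2^-1 ^+ n) => r.
by rewrite le_eqVlt; apply/orP; left; apply/eqP; ring.
Qed.

(** If F were not in the range, James' theorem applied to the functionals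
    Phi (s i) would give h in M below its norm at every Phi x with |x| <= 1. *)
Lemma canonical_map_surjective :
    is_separable X -> closed [set f : dual X | f \in M] -> is_determinant M ->
    (forall f : dual X, f \in M -> norm_attaining f) ->
  forall F : dual (submod_space M), exists x, F = Phi x.
Proof.
move=> /dense_sequence[s sdense] clM detM attM F; apply: contrapT => noF.
have [|t t0 far] := canonical_map_range_far (F := F) detM.
  by move=> x Fx; apply: noF; exists x.
pose rV := realification (submod_space M).
pose U n : {scalar rV} := re_functional (Phi (s n)).
have cV : geometrically_complete rV.
  apply: realification_geometrically_complete.
  apply: closed_submod_geometrically_complete clM.
  exact: dual_geometrically_complete.
have [|n c|h hb] := @separable_family_not_attaining R rV U
    (re_functional F) t (re `|F|) cV t0.
- exact: le_re_functional.
- pose x := \sum_(i < n) of_real k (c i) *: s i.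
  have [v vt] := exists_re_functional_gt (ltW t0) (far x).
  exists v; apply: lt_le_trans vt _.
  rewrite /U /re_functional dual_funB raddfB /= lerD2l lerN2 /evaluation.
  rewrite /x linear_sum raddf_sum /=; apply: ler_sum => i _.
  by rewrite linearZ -reM.
have [x [x1 hx]] := attM _ (valP h).
have [u [u1 ux]] := exists_unimodular (submod_val h x).
have ux1 : `|u *: x| <= 1 by rewrite normrZ u1 mul1r.
have bh : re_functional (Phi (u *: x)) h = `|h|.
  congr re; rewrite -[RHS]hx -ux /= /evaluation; exact: linearZ.
have := hb (re_functional (Phi (u *: x))).
rewrite [X in X < _]bh ltxx => absurd; suff : false by [].
apply: absurd => [v|e e0].
  apply: le_trans (le_re_functional _ _) _; rewrite ler_piMl//.
  rewrite norm_canonical_map// -(of_realK k 1); apply: ler_re.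
  by rewrite rmorph1.
have [i xi] := sdense (u *: x) e e0; exists i => v.
rewrite -lerBlDl /=.
have -> : re_functional (Phi (u *: x)) v - re_functional (Phi (s i)) v
    = re_functional (Phi (u *: x - s i)) v.
  by rewrite /re_functional /= /evaluation linearB raddfB.
apply: le_trans (le_re_functional _ _) _; rewrite ler_wpM2r//.
by rewrite norm_canonical_map.
Qed.

End Surjectivity.

Theorem theorem5 (R : realType) (k : scalar_kind)
    (X : completeNormedModType (scalars R k)) (M : submodClosed (dual X)) :
  is_separable X ->
  closed [set f : dual X | f \in M] ->
  is_determinant M ->
  (forall f : dual X, f \in M -> norm_attaining f) ->
  isometric_isomorphism (@canonical_map R k X M).
Proof.
move=> sepX clM detM attM.
have isoM x := norm_canonical_map x detM.
split=> //; first exact: canonical_map_linear.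
have /choice[g gP] := canonical_map_surjective sepX clM detM attM.
exists g => [x|F]; last by rewrite -gP.
apply/eqP; rewrite -subr_eq0 -normr_eq0 -isoM linearB /= -gP.
by rewrite subrr normr0.
Qed.
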